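(* Let $\lambda\in(0,1]$, set $a(\lambda)=\frac{1-\lambda}{\sqrt{\lambda(2-\lambda)}}$, and define the polynomials $$P_n^\lambda(x)=U_n(x)-2a(\lambda)U_{n-1}(x)-U_{n-2}(x),\qquad n\ge0 .$$ Then the polynomials $(P_n^\lambda)_{n\ge0}$ are orthogonal with respect to the probability measure $$\xi_\lambda(dx)=\frac{a(\lambda)}{\sqrt{a^2(\lambda)+1}}\,\delta_{\sqrt{a^2(\lambda)+1}}(dx)+\frac1\pi\,\frac{\sqrt{1-x^2}}{a^2(\lambda)+1-x^2}\,\mathbf{1}_{\{|x|<1\}}\,dx,$$ and the corresponding Jacobi-Szegö parameters are $\alpha_0=a(\lambda)$, $\alpha_n=0$ for $n\ge1$, $\omega_1=\frac12$, and $\omega_n=\frac14$ for $n\ge2$.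
   Context: $U_n$ denotes the $n$-th Tchebycheff polynomial of the second kind, $U_n(\cos\alpha)=\sin((n+1)\alpha)/\sin\alpha$ for $n\ge0$, with the convention $U_{-1}=U_{-2}:=0$. $\delta_y$ is the Dirac mass at $y$. For a measure $\mu$ on $\mathbb{R}$ with finite moments of all orders and not supported by a finite set, with monic orthogonal polynomials $(P_n)_{n\ge0}$, the Jacobi-Szegö parameters $(\alpha_n,\omega_n)$ are defined by the recurrence $(x-\alpha_n)P_n(x)=P_{n+1}(x)+\omega_nP_{n-1}(x)$, $n\ge0$, $P_{-1}:=0$, with $\alpha_n\in\mathbb{R}$, $\omega_n>0$ (the value $\omega_0$ is irrelevant). *)

(* Defs.v *)
From HB Require Import structures.
From mathcomp Require Import all_boot all_order all_algebra.
From mathcomp Require Import all_classical all_reals all_analysis.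
From mathcomp Require Import measurable_realfun ring.

Set Implicit Arguments.
Unset Strict Implicit.
Unset Printing Implicit Defensive.
Import Order.TTheory GRing.Theory Num.Theory.
Import numFieldNormedType.Exports.

Local Open Scope classical_set_scope.
Local Open Scope ring_scope.

Section chebyshev.
Context {R : realType}.
Implicit Types (p q : {poly R}) (n : nat).

Definition is_chebU n : set {poly R} :=
  [set p | forall t : R, sin t != 0 -> p.[cos t] = sin (n.+1%:R * t) / sin t].

(* Indexed by int so that n - 1 and n - 2 are not truncated; only the negative
   indices -1 and -2 are ever used, and U_(-1) = U_(-2) = 0. *)
Definition chebU (z : int) : {poly R} :=
  if z is Posz n then xget 0 (is_chebU n) else 0.

Lemma is_chebU_ex n : exists p, is_chebU n p.
Proof.
suff [p [q [hp _]]] : exists p q, is_chebU n p /\ is_chebU n.+1 q by exists p.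
elim: n => [|n [p [q [hp hq]]]].
  exists 1, ('X *+ 2); split=> t st0.
    by rewrite hornerC mul1r divff.
  by rewrite hornerMn hornerX mulr_natl mulr2n sinD; field.
exists q, ('X * q *+ 2 - p); split=> // t st0.
rewrite hornerD hornerN hornerMn hornerM hornerX hp// hq//.
have -> : n.+3%:R * t = n.+2%:R * t + t by ring.
have -> : n.+1%:R * t = n.+2%:R * t - t by ring.
by rewrite sinB sinD; field.
Qed.

Lemma is_chebU_unique n p q : is_chebU n p -> is_chebU n q -> p = q.
Proof.
move=> hp hq; apply/eqP; rewrite -subr_eq0; apply/negPn/negP => pq0.
pose u (k : nat) : R := k.+2%:R^-1.
have pu k : root (p - q) (u k).
  have u0 : 0 < u k by rewrite invr_gt0.
  have u1 : u k < 1 by rewrite invf_lt1// ltr1n.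
  have uI : -1 <= u k <= 1 by rewrite (ltW u1) andbT (le_trans _ (ltW u0))// lerN10.
  have su : sin (acos (u k)) != 0.
    rewrite sin_acos// gt_eqF// sqrtr_gt0 subr_gt0.
    by rewrite expr_lt1// ltW.
  have := hp _ su; rewrite -(hq _ su) acosK ?in_itv//= => /eqP.
  by rewrite /root hornerD hornerN subr_eq0.
pose rs := [seq u k | k <- iota 0 (size (p - q)%R)].
have rs_root : all (root (p - q)) rs by apply/allP => _ /mapP[k _ ->].
have rs_uniq : uniq rs.
  rewrite map_inj_uniq ?iota_uniq// => i j /invr_inj/eqP.
  by rewrite eqr_nat !eqSS => /eqP.
by have := max_poly_roots pq0 rs_root rs_uniq; rewrite size_map size_iota ltnn.
Qed.

Lemma chebUP n : is_chebU n (chebU n).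
Proof. by apply: xgetPex; exact: is_chebU_ex. Qed.

End chebyshev.

Section orthogonal_polynomials.
Context {R : realType}.
Implicit Types (mu : {measure set (measurableTypeR R) -> \bar R}).
Implicit Types (P : nat -> {poly R}) (alpha omega : nat -> R).

Definition finite_moments mu : Prop :=
  forall n : nat, mu.-integrable setT (fun x : R => (x ^+ n)%:E).

Definition finitely_supported mu : Prop :=
  exists2 F : set R, finite_set F & mu (~` F) = 0%E.

Definition orthogonal_polys mu P : Prop :=
  [/\ finite_moments mu, (forall n, size (P n) = n.+1) &
      forall m n, m <> n -> (\int[mu]_x ((P m * P n).[x])%:E = 0)%E].

(* omega 0 only ever multiplies P_(-1) = 0, so it is left unconstrained. *)
Definition jacobi_szego mu alpha omega : Prop :=
  [/\ finite_moments mu, ~ finitely_supported mu,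
      (forall n, (0 < n)%N -> 0 < omega n) &
      exists P : nat -> {poly R},
        [/\ orthogonal_polys mu P, (forall n, P n \is monic) &
            forall n, ('X - (alpha n)%:P) * P n =
              P n.+1 + omega n *: (if n is k.+1 then P k else 0)]].

End orthogonal_polynomials.

Section xi.
Context {R : realType}.
Implicit Types (lambda x : R).

Definition aparam lambda : R := (1 - lambda) / Num.sqrt (lambda * (2 - lambda)).

Definition Plambda lambda (n : nat) : {poly R} :=
  chebU n%:Z - (2 * aparam lambda) *: chebU (n%:Z - 1) - chebU (n%:Z - 2).

Definition xi_atom lambda : R := Num.sqrt (aparam lambda ^+ 2 + 1).

Lemma atom_weight_ge0 lambda : 0 < lambda <= 1 -> 0 <= aparam lambda / xi_atom lambda.
Proof.
move=> /andP[_ l1]; apply: divr_ge0; last exact: sqrtr_ge0.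
by apply: divr_ge0; rewrite ?subr_ge0 ?sqrtr_ge0.
Qed.

Definition xi_density lambda x : R :=
  if `|x| < 1
  then pi^-1 * (Num.sqrt (1 - x ^+ 2) / (aparam lambda ^+ 2 + 1 - x ^+ 2)) else 0.

Lemma xi_density_ge0 lambda x : 0 <= xi_density lambda x.
Proof.
rewrite /xi_density; case: ifPn => // x1.
rewrite mulr_ge0 ?invr_ge0 ?pi_ge0// divr_ge0 ?sqrtr_ge0// -addrA addr_ge0//.
  exact: sqr_ge0.
by rewrite subr_ge0 -real_normK ?num_real// expr_le1// ltW.
Qed.

Lemma measurable_xi_density lambda : measurable_fun setT (xi_density lambda).
Proof.
pose num x : R := pi^-1 * Num.sqrt (1 - x ^+ 2).
pose den x : R := aparam lambda ^+ 2 + 1 - x ^+ 2.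
have mnum : measurable_fun setT num.
  apply: measurable_funM => //.
  apply: (measurableT_comp (f := @Num.sqrt R)).
    by apply: continuous_measurable_fun; exact: sqrt_continuous.
  by apply: measurable_funB => //; exact: measurable_funX.
have mden : measurable_fun setT den.
  by apply: measurable_funB => //; exact: measurable_funX.
have minv : measurable_fun setT (@GRing.inv R).
  rewrite -(setvU [set 0]) measurable_funU//; last exact: measurableC.
  split; last exact: measurable_fun_set1.
  apply: open_continuous_measurable_fun.
    by apply: closed_openC; exact: closed_eq.
  by move=> x; rewrite inE => /eqP; exact: inv_continuous.
apply: measurable_fun_if => //.
  by apply: measurable_fun_ltr => //; exact: measurableT_comp.
apply: measurable_funTS; rewrite (_ : (fun x => _) = (fun x => num x * (den x)^-1)).
  by apply: measurable_funM => //; exact: measurableT_comp.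
by apply/funext => x; rewrite /num /den mulrA.
Qed.

Definition xi_ac lambda : set (measurableTypeR R) -> \bar R :=
  fun A => (\int[lebesgue_measure]_(x in A) (xi_density lambda x)%:E)%E.

Let xi_ac0 lambda : xi_ac lambda set0 = 0%E.
Proof. exact: integral_set0. Qed.

Let xi_ac_ge0 lambda A : (0 <= xi_ac lambda A)%E.
Proof. by apply: integral_ge0 => x _; rewrite lee_fin xi_density_ge0. Qed.

Let xi_ac_sigma_additive lambda : semi_sigma_additive (xi_ac lambda).
Proof.
apply: semi_sigma_additive_nng_induced => [|x].
  by apply/measurable_EFinP; exact: measurable_xi_density.
by rewrite lee_fin xi_density_ge0.
Qed.

HB.instance Definition _ lambda := isMeasure.Build _ _ _ (xi_ac lambda)
  (xi_ac0 lambda) (xi_ac_ge0 lambda) (@xi_ac_sigma_additive lambda).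

Definition xi lambda (hlambda : 0 < lambda <= 1) :
    {measure set (measurableTypeR R) -> \bar R} :=
  measure_add
    (mscale (NngNum (atom_weight_ge0 hlambda)) (dirac (xi_atom lambda : measurableTypeR R)))
    (xi_ac lambda).

End xi.

(* Main.v *)
Require Import Defs.
From mathcomp Require Import all_boot all_order all_algebra.
From mathcomp Require Import all_classical all_reals all_analysis.
From mathcomp Require Import measurable_realfun ring lra zify.
Set Implicit Arguments.
Unset Strict Implicit.
Unset Printing Implicit Defensive.
Import Order.TTheory GRing.Theory Num.Theory.
Import numFieldNormedType.Exports.
Local Open Scope classical_set_scope.
Local Open Scope ring_scope.

(** The P_n satisfy a three-term recurrence, so they are orthogonal for a linear
    functional L as soon as L(P_n) = 0 for all n >= 1. For L the integral against
    xi and q = a^2 + 1 - x^2, the factor q kills the atom and the denominator of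
    the density, so L(q U_n) is a semicircle integral, equal to 1/2 for n = 0 and
    to 0 for n >= 1. Since 4 q U_n = P_n - 2a P_(n+1) - P_(n+2) for n >= 1 (with
    a correction for n = 0), L(P_n) = 0 follows by induction from L(1) = 1 and
    L(x) = a, two explicit integrals. The Jacobi-Szego parameters are unique
    because two monic orthogonal families coincide: their difference in degree n
    has degree less than n, hence is orthogonal to itself. *)

(** * Chebyshev recurrences and three-term families *)

Lemma chebU0 (R : realType) : chebU 0%N = 1 :> {poly R}.
Proof.
apply: (is_chebU_unique (chebUP 0)) => t st0.
by rewrite hornerC mul1r divff.
Qed.

Lemma chebU1 (R : realType) : chebU 1%N = 'X *+ 2 :> {poly R}.
Proof.
apply: (is_chebU_unique (chebUP 1)) => t st0.
by rewrite hornerMn hornerX mulr_natl mulr2n sinD; field.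
Qed.

Lemma chebUSS (R : realType) (n : nat) :
  chebU n.+2 = 'X * chebU n.+1 *+ 2 - chebU n :> {poly R}.
Proof.
apply: (is_chebU_unique (chebUP n.+2)) => t st0.
rewrite hornerD hornerN hornerMn hornerM hornerX !chebUP//.
have -> : n.+3%:R * t = n.+2%:R * t + t :> R by ring.
have -> : n.+1%:R * t = n.+2%:R * t - t :> R by ring.
by rewrite sinB sinD; field.
Qed.

Lemma Plambda0 (R : realType) (lambda : R) : Plambda lambda 0 = 1.
Proof.
have -> : Plambda lambda 0 = chebU 0%N - (2 * aparam lambda) *: 0 - 0 by [].
by rewrite scaler0 !subr0 chebU0.
Qed.

Lemma Plambda1 (R : realType) (lambda : R) :
  Plambda lambda 1 = 2 *: ('X - (aparam lambda)%:P).
Proof.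
have -> : Plambda lambda 1 =
  chebU 1%N - (2 * aparam lambda) *: chebU 0%N - 0 by [].
rewrite subr0 chebU0 chebU1 scalerBr scaler_nat; congr (_ - _).
by rewrite -alg_polyC scalerA.
Qed.

Lemma PlambdaSS (R : realType) (lambda : R) (n : nat) :
  Plambda lambda n.+2 =
  chebU n.+2 - (2 * aparam lambda) *: chebU n.+1 - chebU n.
Proof.
rewrite /Plambda; have -> : n.+2%:Z - 1 = n.+1 by lia.
by have -> : n.+2%:Z - 2 = n by lia.
Qed.

(** Running the recurrence of the U_n backwards would give U_(-2) = -1 and hence P_0 = 2. The
    convention U_(-2) = 0 gives P_0 = 1 instead, so this step has the constant 2 where [PlambdaSSS]
    has the previous polynomial. This is the origin of omega_1 = 1/2. *)
Lemma Plambda2 (R : realType) (lambda : R) :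
  Plambda lambda 2 = 2 *: ('X * Plambda lambda 1) - 2%:P.
Proof.
rewrite PlambdaSS Plambda1 chebUSS chebU1 chebU0.
by rewrite -!mul_polyC; ring.
Qed.

Lemma PlambdaSSS (R : realType) (lambda : R) (n : nat) :
  Plambda lambda n.+3 = 2 *: ('X * Plambda lambda n.+2) - Plambda lambda n.+1.
Proof.
(* At n = 0 the term P_1 involves U_(-1) = 0, so it is outside the reach of [PlambdaSS]. *)
rewrite !PlambdaSS (chebUSS R n.+1); case: n => [|n].
  rewrite Plambda1 chebUSS chebU1 chebU0.
  by rewrite -!mul_polyC; ring.
by rewrite PlambdaSS !chebUSS -!mul_polyC; ring.
Qed.

Lemma monic_addl_lt (R : nzRingType) (p q : {poly R}) :
  (size q < size p)%N -> p \is monic -> p + q \is monic.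
Proof. by move=> qp; rewrite !monicE lead_coefDl. Qed.

(** * Families given by a three-term recurrence *)

Section three_term.
Context {R : realType}.
Implicit Types (P : nat -> {poly R}) (alpha omega : nat -> R).

Definition three_term P alpha omega := forall n,
  ('X - (alpha n)%:P) * P n =
  P n.+1 + omega n *: (if n is k.+1 then P k else 0).

Lemma three_term_monic P alpha omega : P 0%N = 1 -> three_term P alpha omega ->
  forall n, P n \is monic /\ size (P n) = n.+1.
Proof.
move=> P0 rec n.
(* The recurrence reaches back two indices, so the induction carries two consecutive ones. *)
suff [] : (P n \is monic /\ size (P n) = n.+1) /\
          (P n.+1 \is monic /\ size (P n.+1) = n.+2) by [].
have step k (q : {poly R}) c : P k \is monic -> size (P k) = k.+1 -> (size q <= k.+1)%N ->
    P k.+1 = ('X - c%:P) * P k - q -> P k.+1 \is monic /\ size (P k.+1) = k.+2.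
  move=> mPk sPk sq ->.
  have sXP : size (('X - c%:P) * P k) = k.+2.
    by rewrite size_monicM ?monicXsubC ?monic_neq0// size_XsubC sPk.
  split; last by rewrite size_polyDl ?sXP// size_polyN.
  by apply: monic_addl_lt; rewrite ?monicMl ?monicXsubC// sXP size_polyN.
have recE k : P k.+1 = ('X - (alpha k)%:P) * P k -
    omega k *: (if k is j.+1 then P j else 0) by rewrite rec addrK.
elim: n => [|n [[m0 s0] [m1 s1]]].
  rewrite P0 monic1 size_poly1; split=> //.
  apply: (step _ _ _ _ _ _ (recE 0%N)); rewrite ?P0 ?monic1 ?size_poly1//.
  by rewrite scaler0 size_poly0.
split=> //; apply: (step _ _ _ _ _ _ (recE n.+1)) => //.
by apply: leq_trans (size_scale_leq _ _) _; rewrite s0.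
Qed.

(** Subtracting the two recurrences gives (alpha'_n - alpha_n) P_n = (omega_n - omega'_n) P_(n-1).
    The right side has smaller degree than P_n, so the first coefficient vanishes, and then so does
    the second because P_(n-1) is nonzero. *)
Lemma three_term_coef_unique P alpha omega alpha' omega' :
  (forall n, size (P n) = n.+1) ->
  three_term P alpha omega -> three_term P alpha' omega' ->
  forall n, alpha n = alpha' n /\ ((0 < n)%N -> omega n = omega' n).
Proof.
move=> sP rec rec' n.
have eqn : (alpha' n - alpha n) *: P n =
    (omega n - omega' n) *: (if n is k.+1 then P k else 0).
  have -> : (alpha' n - alpha n) *: P n =
      ('X - (alpha n)%:P) * P n - ('X - (alpha' n)%:P) * P n.
    by rewrite -mul_polyC rmorphB/=; ring.
  by rewrite rec rec' scalerBl; ring.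
have P0 k : P k != 0 by rewrite -size_poly_gt0 sP.
have aE : alpha n = alpha' n.
  apply/eqP; rewrite eq_sym -subr_eq0; apply/negP => /negP a0.
  have := congr1 (fun p : {poly R} => size p) eqn.
  rewrite size_scale// sP; case: n {eqn a0} => [|n].
    by rewrite scaler0 size_poly0.
  move=> E; have := size_scale_leq (omega n.+1 - omega' n.+1) (P n).
  by rewrite -E sP ltnn.
split=> //; case: n eqn aE => // n /[swap] -> + _.
rewrite subrr scale0r => /esym/eqP.
by rewrite scaler_eq0 subr_eq0 (negPf (P0 n)) orbF => /eqP.
Qed.

End three_term.

(** * The products q U_n in terms of the P_n *)

Section chebyshev_kernel.
Context {R : realType}.
Variable lambda : R.

Definition atom_poly : {poly R} := (aparam lambda ^+ 2 + 1)%:P - 'X^2.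

(* With z the shift of the index of U_n, P_n corresponds to z^2 - 2az - 1, and
   4(a^2 + 1 - x^2) to -(z^4 - (4a^2 + 2)z^2 + 1) / z^2
   = -(z^2 - 2az - 1)(z^2 + 2az - 1) / z^2; the relation breaks down at U_0,
   because of the convention U_(-2) = 0. *)
Lemma atom_polyE0 : 4 *: atom_poly =
  1 - (Plambda lambda 2 + (2 * aparam lambda) *: Plambda lambda 1 - 1).
Proof.
rewrite /atom_poly Plambda2 Plambda1 -!mul_polyC.
ring.
Qed.

Lemma atom_polyEU n : 4 *: (atom_poly * chebU n.+1) = Plambda lambda n.+1 -
  (Plambda lambda n.+3 + (2 * aparam lambda) *: Plambda lambda n.+2).
Proof.
rewrite /atom_poly !PlambdaSS; case: n => [|n].
  rewrite Plambda1 !chebUSS chebU1 chebU0.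
  rewrite -!mul_polyC; ring.
rewrite PlambdaSS !chebUSS.
rewrite -!mul_polyC; ring.
Qed.

End chebyshev_kernel.

(** * Orthogonality for a linear functional on polynomials *)

Section moment_functional.
Context {R : realType} (L : {poly R} -> R).
Hypothesis L_linear : forall c p q, L (c *: p + q) = c * L p + L q.

Lemma momentD p q : L (p + q) = L p + L q.
Proof. by rewrite -[p]scale1r L_linear mul1r scale1r. Qed.

Lemma moment0 : L 0 = 0.
Proof. by apply: (addrI (L 0)); rewrite -momentD !addr0. Qed.

Lemma momentZ c p : L (c *: p) = c * L p.
Proof. by rewrite -[_ *: p]addr0 L_linear moment0 addr0. Qed.

Lemma momentB p q : L (p - q) = L p - L q.
Proof. by rewrite -scaleN1r momentD momentZ mulN1r. Qed.

(* A family with one polynomial of each degree spans, so orthogonality to it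
   is orthogonality to all polynomials of lower degree. *)
Lemma moment_low_degree (P : nat -> {poly R}) (n : nat) (r : {poly R}) :
  (forall k, size (P k) = k.+1) ->
  (forall k, (k < n)%N -> L (P k * r) = 0) ->
  forall q : {poly R}, (size q <= n)%N -> L (q * r) = 0.
Proof.
move=> sP LP q; move: {2}(size q) (leqnn (size q)) => m.
elim: m q => [|m IH] q.
  by rewrite leqn0 size_poly_eq0 => /eqP -> _; rewrite mul0r moment0.
move=> qm qn; have [qm'|mq] := leqP (size q) m; first exact: IH.
have sq : size q = m.+1 by apply/eqP; rewrite eqn_leq qm.
have lP : lead_coef (P m) != 0.
  by rewrite lead_coef_eq0 -size_poly_gt0 sP.
(* Chosen so that [q - c *: P m] loses its leading term. *)
pose c := lead_coef q / lead_coef (P m).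
have -> : q = c *: P m + (q - c *: P m) by rewrite addrC subrK.
have sd : (size (q - c *: P m)%R <= m)%N.
  apply/leq_sizeP => j; rewrite leq_eqVlt => /predU1P[<-|mj].
    rewrite coefB coefZ /c; have := lead_coefE q; rewrite sq/= => <-.
    by have := lead_coefE (P m); rewrite sP/= => <-; rewrite divfK ?subrr.
  have /leq_sizeP/(_ j mj) : (size q <= m.+1)%N by [].
  have /leq_sizeP/(_ j mj) : (size (P m) <= m.+1)%N by rewrite sP.
  by rewrite coefB coefZ => -> ->; rewrite mulr0 subrr.
rewrite mulrDl momentD -scalerAl momentZ LP ?mulr0 ?add0r; last by rewrite -sq.
by apply: IH => //; rewrite (leq_trans sd)// ltnW// -sq.
Qed.

(** Multiplication by X lowers the index by at most one. Hence for k < n the product X^k P_n stays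
    in the span of the P_j with j >= 1, where L vanishes. Since P_m is a combination of X^k with k
    <= m, this settles m < n. *)
Lemma three_term_orthogonal (P : nat -> {poly R}) (alpha omega : nat -> R) :
  P 0%N = 1 -> three_term P alpha omega ->
  (forall n, (0 < n)%N -> L (P n) = 0) ->
  forall m n, m <> n -> L (P m * P n) = 0.
Proof.
move=> P0 rec LP.
have LX k n : (k < n)%N -> L ('X^k * P n) = 0.
  elim: k n => [|k IH] [//|n] kn; first by rewrite mul1r LP.
  have -> : 'X^(k.+1) * P n.+1 = 'X^k * P n.+2 +
      omega n.+1 *: ('X^k * P n) + alpha n.+1 *: ('X^k * P n.+1).
    rewrite exprSr -mulrA.
    have -> : 'X * P n.+1 = P n.+2 + omega n.+1 *: P n + alpha n.+1 *: P n.+1.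
      by rewrite -(rec n.+1) -mul_polyC; ring.
    by rewrite -!mul_polyC; ring.
  by rewrite !momentD !momentZ !IH ?mulr0 ?addr0// ltnW// ltnW.
have Llt m n : (m < n)%N -> L (P m * P n) = 0.
  move=> mn; apply: (@moment_low_degree (fun k => 'X^k) n).
  - by move=> k; rewrite size_polyXn.
  - by move=> k; exact: LX.
  - by rewrite (three_term_monic P0 rec m).2.
by move=> m n /eqP; rewrite neq_ltn => /orP[/Llt//|/Llt]; rewrite mulrC.
Qed.

End moment_functional.

(** * Moments of a measure and uniqueness of monic orthogonal families *)

Section moments.
Context {R : realType} (mu : {measure set (measurableTypeR R) -> \bar R}).
Hypothesis fm : finite_moments mu.
Implicit Types p q d : {poly R}.

Definition moment p : R := (\int[mu]_x p.[x])%R.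

Lemma integrable_horner p : mu.-integrable setT (fun x => p.[x]%:E).
Proof.
have -> : (fun x => p.[x]%:E) =
    (fun x => \sum_(i < size p) ((p`_i)%:E * (x ^+ i)%:E)%E).
  by apply/funext => x; rewrite horner_coef -sumEFin.
by apply: integrable_sum => // i _; apply: integrableZl => //; exact: fm.
Qed.

Lemma integral_moment p : (\int[mu]_x p.[x]%:E = (moment p)%:E)%E.
Proof.
by rewrite fineK//; apply: integrable_fin_num => //; exact: integrable_horner.
Qed.

Lemma moment_linear c p q : moment (c *: p + q) = c * moment p + moment q.
Proof.
rewrite /moment -RintegralZl//; last exact: integrable_horner.
rewrite -RintegralD//; last 2 first.
- have := integrable_horner (c *: p); rewrite (_ : (fun x => _) = EFin \o (fun x => c * p.[x])) //.
  by apply/funext => x; rewrite /= hornerZ.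
- exact: integrable_horner.
by apply: eq_Rintegral => x _; rewrite hornerD hornerZ.
Qed.

Lemma finite_roots d : d != 0 -> finite_set [set x | root d x].
Proof.
move=> d0; apply: contrapT => /(infinite_set_fset (size d)) [B Bd].
rewrite leqNgt => /negP; apply; apply: max_poly_roots => //.
  by apply/allP => x /Bd.
exact: finmap.fset_uniq.
Qed.

(** A nonnegative function with zero integral vanishes almost everywhere, so the measure would be
    carried by the roots of d, a finite set if d were nonzero. *)
Lemma moment_sqr_eq0 d : ~ finitely_supported mu -> moment (d * d) = 0 -> d = 0.
Proof.
move=> nfs d20; apply/eqP/negPn/negP => /finite_roots fd; apply: nfs.
exists [set x | root d x] => //.
have : (\int[mu]_x `|(d * d).[x]%:E| = 0)%E.
  rewrite -[RHS]/(0%:E) -d20 -integral_moment; apply: eq_integral => x _.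
  by rewrite gee0_abs// lee_fin hornerM sqr_ge0.
move/(ae_eq_integral_abs mu measurableT) => /(_ _)[].
  by apply/measurable_EFinP; exact: measurable_poly.
move=> N [mN N0 sN]; apply: (subset_measure0 _ mN _ N0).
  by apply: measurableC; exact/countable_measurable/finite_set_countable.
move=> x /= /negP dx; apply: sN => /= /(_ I) [] /eqP.
by rewrite hornerM mulf_eq0 orbb; exact/negP.
Qed.

Lemma monic_orthogonal_polys_unique (P Q : nat -> {poly R}) :
  ~ finitely_supported mu ->
  orthogonal_polys mu P -> orthogonal_polys mu Q ->
  (forall n, P n \is monic) -> (forall n, Q n \is monic) -> P =1 Q.
Proof.
move=> nfs [_ sP oP] [_ sQ oQ] mP mQ n; apply/eqP; rewrite -subr_eq0; apply/eqP.
apply: moment_sqr_eq0 => //.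
have sd : (size (P n - Q n)%R <= n)%N.
  apply/leq_sizeP => j; rewrite leq_eqVlt => /predU1P[<-|nj].
    have := monicP (mP n); have := monicP (mQ n).
    by rewrite !lead_coefE sP sQ coefB /= => -> ->; rewrite subrr.
  have /leq_sizeP/(_ j nj) : (size (P n) <= n.+1)%N by rewrite sP.
  have /leq_sizeP/(_ j nj) : (size (Q n) <= n.+1)%N by rewrite sQ.
  by rewrite coefB => -> ->; rewrite subrr.
(* Stated for a generic family because it is used for both P and Q: the square of P_n - Q_n is the
   difference of its products with P_n and with Q_n. *)
have low (S : nat -> {poly R}) : (forall k, size (S k) = k.+1) ->
    (forall m n, m <> n -> (\int[mu]_x ((S m * S n).[x])%:E = 0)%E) ->
    moment ((P n - Q n) * S n) = 0.
  move=> sS oS; apply: (moment_low_degree moment_linear sS _ sd) => k kn.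
  apply: EFin_inj; rewrite -integral_moment oS//.
  by apply/eqP; rewrite ltn_eqF.
by rewrite mulrBr (momentB moment_linear) !low ?subrr.
Qed.

End moments.

(** * Integrals over ]-1, 1[ *)

Section integral_density.
Context d (T : measurableType d) (R : realType).
Variables (mu nu : {measure set T -> \bar R}) (g : T -> R).
Hypotheses (mg : measurable_fun setT g) (g0 : forall x, 0 <= g x).
Hypothesis nuE :
  forall A, measurable A -> (nu A = \int[mu]_(x in A) (g x)%:E)%E.
Local Open Scope ereal_scope.
Import HBNNSimple.

Let g0E x : 0 <= (g x)%:E. Proof. by rewrite lee_fin. Qed.
Let mgE : measurable_fun setT (EFin \o g).
Proof. exact/measurable_EFinP. Qed.

(** On indicators this is [nuE]; linearity extends it to simple functions and monotone convergence
    to f, the products with g staying increasing because g >= 0. *)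
Lemma ge0_integral_density (f : T -> \bar R) : (forall x, 0 <= f x) ->
  measurable_fun setT f -> \int[nu]_x f x = \int[mu]_x (f x * (g x)%:E).
Proof.
move=> f0 mf; pose h := nnsfun_approx measurableT mf.
have hf x : (EFin \o h n) x @[n --> \oo] --> f x.
  exact: cvg_nnsfun_approx.
have -> : \int[nu]_x f x = lim (\int[nu]_x (EFin \o h n) x @[n --> \oo]).
  rewrite -monotone_convergence//=.
  - by apply: eq_integral => x _; apply/esym/cvg_lim => //; exact: hf.
  - by move=> n; exact/measurable_EFinP.
  - by move=> n x _; rewrite lee_fin.
  - by move=> x _ a b ab; rewrite lee_fin; exact/lefP/nd_nnsfun_approx.
have -> : \int[mu]_x (f x * (g x)%:E) =
    lim (\int[mu]_x ((EFin \o h n) x * (g x)%:E) @[n --> \oo]).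
  rewrite -monotone_convergence//=.
  - apply: eq_integral => x _; apply/esym/cvg_lim => //.
    by apply: cvgeZr => //; exact: hf.
  - by move=> n; apply: emeasurable_funM => //; exact/measurable_EFinP.
  - by move=> n x _; rewrite mule_ge0// lee_fin.
  - by move=> x _ a b ab; rewrite lee_wpmul2r// lee_fin; exact/lefP/nd_nnsfun_approx.
suff E n : \int[nu]_x (EFin \o h n) x = \int[mu]_x ((EFin \o h n) x * (g x)%:E).
  by under eq_fun do rewrite E.
have indic0 r x : 0 <= (r * \1_(h n @^-1` [set r]) x)%:E.
  exact: nnfun_muleindic_ge0.
have mindic r : measurable_fun setT (fun x => (r * \1_(h n @^-1` [set r]) x)%:E).
  by apply/measurable_EFinP; exact: measurable_funM.
(* The simple function is split over its level sets, where [nuE] applies. *)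
transitivity (\int[nu]_x \sum_(y \in range (h n)) (y * \1_(h n @^-1` [set y]) x)%:E).
  by apply: eq_integral => x _; rewrite /= fimfunE -fsumEFin.
rewrite ge0_integral_fsum//.
transitivity (\int[mu]_x \sum_(y \in range (h n))
    ((y * \1_(h n @^-1` [set y]) x)%:E * (g x)%:E)); last first.
  apply: eq_integral => x _; rewrite -ge0_mule_fsuml//.
  by rewrite fsumEFin// -fimfunE.
rewrite ge0_integral_fsum//; last 2 first.
- by move=> r; exact: emeasurable_funM.
- by move=> r x _; exact: mule_ge0.
apply: eq_fsbigr => r rh.
under eq_integral do rewrite EFinM.
under [RHS]eq_integral do rewrite EFinM -muleA.
rewrite integralZl_indic_nnsfun//.
rewrite ge0_integralZl//; last 3 first.
- by apply: emeasurable_funM => //; exact/measurable_EFinP.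
- by move=> x _; rewrite mule_ge0// lee_fin.
- by case: (set_mem rh) => t _ <-; rewrite lee_fin.
rewrite integral_indic// setIT nuE//; congr (_ * _).
rewrite [LHS]integral_mkcond; apply: eq_integral => x _.
by rewrite epatch_indic muleC.
Qed.

(** Multiplication by g >= 0 commutes with taking positive and negative parts. *)
Lemma integral_density (f : T -> \bar R) : measurable_fun setT f ->
  \int[nu]_x f x = \int[mu]_x (f x * (g x)%:E).
Proof.
move=> mf; rewrite [LHS]integralE [RHS]integralE.
rewrite !ge0_integral_density//; last 2 first.
- exact: measurable_funeneg.
- exact: measurable_funepos.
by congr (_ - _); apply: eq_integral => x _;
  rewrite ?(funeposE, funenegE) maxe_pMl ?mul0e ?muleNN ?mulNe// lee_fin.
Qed.

End integral_density.

(** * Exhaustion of ]-1, 1[ by compact intervals *)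

Section sin_atan_exhaustion.
Context {R : realType}.
Implicit Types (f F : R -> R) (x : R) (n : nat).

(* These points satisfy x / sqrt(1 - x^2) = n + 1, so the antiderivatives
   below take explicit values there. *)
Definition sin_atan n : R := sin (atan n.+1%:R).

Let atan_itv x : atan x \in `[- (pi / 2), pi / 2].
Proof. by rewrite in_itv/= (ltW (atan_gtNpi2 x)) (ltW (atan_ltpi2 x)). Qed.

Lemma asin_sin_atan n : asin (sin_atan n) = atan n.+1%:R.
Proof. exact: sinK. Qed.

Lemma asinN_sin_atan n : asin (- sin_atan n) = - atan n.+1%:R.
Proof. by rewrite -sinN sinK// in_itv/= lerNl opprK lerNl andbC; exact: atan_itv. Qed.

Lemma sqrt_sin_atan n :
  Num.sqrt (1 - sin_atan n ^+ 2) = cos (atan n.+1%:R).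
Proof.
rewrite /sin_atan -cos2sin2 sqrtr_sqr gtr0_norm//.
by rewrite cos_gt0_pihalf// atan_gtNpi2 atan_ltpi2.
Qed.

Lemma sin_atan_div n :
  sin_atan n / Num.sqrt (1 - sin_atan n ^+ 2) = n.+1%:R.
Proof. by rewrite sqrt_sin_atan -[RHS]atanK. Qed.

Lemma homo_sin_atan : {homo sin_atan : m n / (m <= n)%N >-> m <= n}.
Proof.
move=> m n; rewrite leq_eqVlt => /predU1P[->//|mn].
by rewrite ltW// ltr_sin// lt_atan// ltr_nat.
Qed.

Lemma sin_atan_gt0 n : 0 < sin_atan n.
Proof.
rewrite -sin0 ltr_sin//; last by rewrite in_itv/= oppr_le0 divr_ge0// pi_ge0.
by rewrite -atan0 lt_atan// ltr0n.
Qed.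

Lemma sin_atan_lt1 n : sin_atan n < 1.
Proof.
rewrite -sin_pihalf ltr_sin// ?atan_ltpi2// in_itv/= lexx andbT.
by rewrite lerNl (le_trans _ (divr_ge0 (pi_ge0 R) _))// oppr_le0 divr_ge0// pi_ge0.
Qed.

Lemma cvg_atanM_nat (c : R) : 0 < c -> atan (c * n.+1%:R) @[n --> \oo] --> pi / 2.
Proof.
move=> c0; have /cvg_comp : c * n.+1%:R @[n --> \oo] --> +oo.
  apply/cvgryPge => A; near=> n; rewrite mulrC -ler_pdivrMr//.
  rewrite (@le_trans _ _ n%:R) ?ler_nat//; near: n; exact: nbhs_infty_ger.
by apply; exact: cvgy_atan.
Unshelve. all: by end_near. Qed.

Lemma cvg_atan_nat : atan n.+1%:R @[n --> \oo] --> (pi / 2 : R).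
Proof. by under eq_fun do rewrite -[_%:R]mul1r; exact: cvg_atanM_nat. Qed.

Lemma cvg_sin_atan : sin_atan n @[n --> \oo] --> (1 : R).
Proof.
rewrite -[X in _ --> X](sin_pihalf R); apply: continuous_cvg.
  exact: continuous_sin.
exact: cvg_atan_nat.
Qed.

Lemma cvg_cos_atan : cos (atan n.+1%:R) @[n --> \oo] --> (0 : R).
Proof.
rewrite -[X in _ --> X](cos_pihalf R); apply: continuous_cvg.
  exact: continuous_cos.
exact: cvg_atan_nat.
Qed.

Lemma bigcup_sin_atan :
  \bigcup_n `[- sin_atan n, sin_atan n]%classic = `]-1, 1[%classic :> set R.
Proof.
apply/seteqP; split=> x /=.
  move=> [n _] /=; rewrite !in_itv/= => /andP[nx xn].
  rewrite (le_lt_trans xn (sin_atan_lt1 n)) andbT (lt_le_trans _ nx)//.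
  by rewrite ltrN2 sin_atan_lt1.
rewrite in_itv/= -ltr_norml => x1.
have [n _ xn] : \forall n \near \oo, `|x| < sin_atan n.
  by apply: cvgr_gt x1; exact: cvg_sin_atan.
by exists n => //=; rewrite in_itv/= -ler_norml ltW//; exact: xn (leqnn n).
Qed.

(** For antiderivatives written with y / sqrt(1 - y^2), which blows up at the endpoints: the
    fundamental theorem is applied on each compact interval, and nonnegativity of f lets the
    integrals pass to the increasing union. *)
Lemma ge0_integral_oo_FTC f F (l : R) :
  (forall x, -1 < x < 1 -> 0 <= f x) ->
  (forall x, -1 < x < 1 -> {for x, continuous f}) ->
  (forall x, -1 < x < 1 -> is_derive x 1 F (f x)) ->
  F (sin_atan n) - F (- sin_atan n) @[n --> \oo] --> l ->
  (\int[lebesgue_measure]_(x in `](-1)%R, 1%R[) (f x)%:E = l%:E)%E.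
Proof.
move=> f0 cf dF Fl.
have inI n x : x \in `[- sin_atan n, sin_atan n] -> -1 < x < 1.
  rewrite in_itv/= => /andP[nx xn].
  rewrite (le_lt_trans xn (sin_atan_lt1 n)) andbT (lt_le_trans _ nx)//.
  by rewrite ltrN2 sin_atan_lt1.
have cfn n : {within `[- sin_atan n, sin_atan n], continuous f}.
  by apply: continuous_in_subspaceT => x /set_mem/inI; exact: cf.
have dFc x : -1 < x < 1 -> {for x, continuous F}.
  move=> x1; apply: differentiable_continuous; apply/derivable1_diffP.
  by have [] := dF _ x1.
pose I n : set R := `[- sin_atan n, sin_atan n]%classic.
have nI : nondecreasing_seq I.
  move=> m n mn; rewrite subsetEset => x; rewrite /I/= !in_itv/= => /andP[a b].
  rewrite (le_trans _ a) ?lerN2 ?homo_sin_atan//=.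
  by rewrite (le_trans b)// homo_sin_atan.
have intI n : (\int[lebesgue_measure]_(x in I n) (f x)%:E =
    (F (sin_atan n) - F (- sin_atan n))%:E)%E.
  apply: continuous_FTC2 => //.
  - by rewrite -subr_gt0 opprK addr_gt0// sin_atan_gt0.
  - have s1 : -1 < sin_atan n < 1.
      by rewrite sin_atan_lt1 (lt_trans _ (sin_atan_gt0 n))// ltrN10.
    have Ns1 : -1 < - sin_atan n < 1.
      by rewrite ltrN2 sin_atan_lt1 ltrNl (lt_trans _ (sin_atan_gt0 n))// ltrN10.
    split.
    + move=> x xI; have /inI/dF[] : x \in `[- sin_atan n, sin_atan n] => //.
      exact: subset_itv_oo_cc.
    + exact/cvg_at_right_filter/dFc.
    + exact/cvg_at_left_filter/dFc.
  - move=> x xI; rewrite derive1E.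
    have /inI/dF[_ //] : x \in `[- sin_atan n, sin_atan n].
    exact: subset_itv_oo_cc.
rewrite -bigcup_sin_atan.
have : (\int[lebesgue_measure]_(x in I n) (f x)%:E)%E @[n --> \oo] -->
    (\int[lebesgue_measure]_(x in \bigcup_n I n) (f x)%:E)%E.
  apply: ge0_nondecreasing_set_cvg_integral => //.
  - by move=> n; exact: measurable_itv.
  - move=> n; apply/measurable_EFinP.
    by apply: subspace_continuous_measurable_fun; [exact: measurable_itv|exact: cfn].
  - by move=> n x /inI; rewrite lee_fin; exact: f0.
under eq_fun do rewrite intI.
move=> h; apply: (cvg_unique _ h) => //.
by apply: cvg_EFin => //; near=> n.
Unshelve. all: by end_near. Qed.

End sin_atan_exhaustion.

(** * Explicit antiderivatives and the integrals they give *)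

Section antiderivatives.
Context {R : realType}.
Implicit Types x a : R.

Definition sqrt1B x : R := Num.sqrt (1 - x ^+ 2).

Lemma subr1_sqr_gt0 x : -1 < x < 1 -> 0 < 1 - x ^+ 2.
Proof. by move=> /andP[x1 x2]; nra. Qed.

Lemma sqrt1B_gt0 x : -1 < x < 1 -> 0 < sqrt1B x.
Proof. by move=> /subr1_sqr_gt0; rewrite sqrtr_gt0. Qed.

Lemma sqr_sqrt1B x : -1 < x < 1 -> sqrt1B x ^+ 2 = 1 - x ^+ 2.
Proof. by move=> /subr1_sqr_gt0/ltW/sqr_sqrtr. Qed.

Lemma continuous_sqrt1B : continuous sqrt1B.
Proof.
move=> x; rewrite /sqrt1B.
apply: (@continuous_comp _ _ _ (fun y : R => 1 - y ^+ 2) (@Num.sqrt R) x).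
  by apply: cvgB; [exact: cvg_cst|exact: exprn_continuous].
exact: sqrt_continuous.
Qed.

Lemma is_derive_sqrt1B x : -1 < x < 1 -> is_derive x 1 sqrt1B (- x / sqrt1B x).
Proof.
move=> x1; have d0 := subr1_sqr_gt0 x1.
have w0 := lt0r_neq0 (sqrt1B_gt0 x1).
have dq : is_derive x 1 (fun y : R => 1 - y ^+ 2) (- (2 * x)).
  apply: is_derive_eq; rewrite /GRing.scale/=; ring.
have := @is_derive1_comp R Num.sqrt (fun y => 1 - y ^+ 2) x _ _ (is_derive1_sqrt d0) dq.
move=> /is_derive_eq; apply.
by rewrite -/(sqrt1B x); field.
Qed.

Lemma is_derive_semicircle x : -1 < x < 1 ->
  is_derive x 1 (fun y => 2^-1 * (y * sqrt1B y + asin y)) (sqrt1B x).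
Proof.
move=> x1; have w0 := lt0r_neq0 (sqrt1B_gt0 x1); have w2 := sqr_sqrt1B x1.
have dw := is_derive_sqrt1B x1; have da := is_derive1_asin x1.
apply: is_derive_eq; rewrite -/(sqrt1B x) /GRing.scale/=.
by field: w2.
Qed.

Lemma is_derive_tan_asin x : -1 < x < 1 ->
  is_derive x 1 (fun y => y / sqrt1B y) (sqrt1B x ^- 3).
Proof.
move=> x1; have w0 := lt0r_neq0 (sqrt1B_gt0 x1); have w2 := sqr_sqrt1B x1.
have dw := is_derive_sqrt1B x1; have dv := is_deriveV w0 dw.
apply: is_derive_eq; rewrite /GRing.scale/=.
by field: w2.
Qed.

(** With w = sqrt(1 - y^2) one has w dw = -y dy, so the integrand becomes -w^2 / (a^2 + w^2) dw =
    (a^2 / (a^2 + w^2) - 1) dw. *)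
Lemma is_derive_atan_sqrt1B a x : -1 < x < 1 ->
  is_derive x 1 (fun y => a * atan (sqrt1B y / a) - sqrt1B y)
    (x * (sqrt1B x / (a ^+ 2 + 1 - x ^+ 2))).
Proof.
move=> x1; have w0 := lt0r_neq0 (sqrt1B_gt0 x1); have w2 := sqr_sqrt1B x1.
have dw := is_derive_sqrt1B x1.
rewrite -addrA -w2.
(* The case a = 0 occurs for lambda = 1. The factor a then kills the arctangent, whatever value
   division by zero takes. *)
have [->|a0] := eqVneq a 0.
  rewrite (_ : (fun y => _) = (fun y => - sqrt1B y)); last first.
    by apply/funext => y; rewrite mul0r sub0r.
  by apply: is_derive_eq; field.
have dwa : is_derive x 1 (fun y => sqrt1B y / a) (- x / sqrt1B x / a).
  by apply: is_derive_eq; rewrite /GRing.scale/=; ring.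
have := @is_derive1_comp R atan (fun y => sqrt1B y / a) x _ _ (is_derive1_atan _) dwa.
rewrite /comp => dat.
apply: is_derive_eq; rewrite /GRing.scale/=.
have : a ^+ 2 + sqrt1B x ^+ 2 != 0 by rewrite lt0r_neq0// ltr_wpDr ?sqr_ge0// exprn_even_gt0.
move: (sqrt1B x) w0 => w w0 aw; by field; rewrite w0 a0 aw.
Qed.

(** With y = sin t the integrand is (1 - a^2 / (a^2 + cos^2 t)) dt. Putting u = tan t = y / sqrt(1 -
    y^2) and s^2 = a^2 + 1, the subtracted term becomes a^2 / (s^2 + a^2 u^2) du, an arctangent of a
    u / s. *)
Lemma is_derive_kernel a x : -1 < x < 1 ->
  is_derive x 1 (fun y => asin y -
      a / Num.sqrt (a ^+ 2 + 1) * atan (a / Num.sqrt (a ^+ 2 + 1) * (y / sqrt1B y)))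
    (sqrt1B x / (a ^+ 2 + 1 - x ^+ 2)).
Proof.
move=> x1; have w0 := lt0r_neq0 (sqrt1B_gt0 x1); have w2 := sqr_sqrt1B x1.
have dt := is_derive_tan_asin x1; have da := is_derive1_asin x1.
have s2 : Num.sqrt (a ^+ 2 + 1) ^+ 2 = a ^+ 2 + 1.
  by rewrite sqr_sqrtr// addr_ge0// sqr_ge0.
have s0 : Num.sqrt (a ^+ 2 + 1) != 0.
  by rewrite -sqrf_eq0 s2 lt0r_neq0// ltr_wpDl// sqr_ge0.
move: (Num.sqrt (a ^+ 2 + 1)) s0 s2 => s s0 s2.
have dct : is_derive x 1 (fun y => a / s * (y / sqrt1B y)) (a / s * sqrt1B x ^- 3).
  by apply: is_derive_eq; rewrite /GRing.scale/=; ring.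
have := @is_derive1_comp R atan (fun y => a / s * (y / sqrt1B y)) x _ _
  (is_derive1_atan _) dct.
rewrite /comp => dat.
apply: is_derive_eq; rewrite /GRing.scale/= -/(sqrt1B x).
have : a ^+ 2 + sqrt1B x ^+ 2 != 0.
  by rewrite lt0r_neq0// ltr_wpDl ?sqr_ge0// exprn_even_gt0.
rewrite -[a ^+ 2 + 1 - _]addrA -w2.
move: (sqrt1B x) w0 w2 => w w0 w2 aw.
(* The numerator s^2 w^2 + a^2 x^2 reduces to a^2 + w^2 by s^2 = a^2 + 1 and x^2 = 1 - w^2. *)
have -> : 1 + (a / s * (x / w)) ^+ 2 = (a ^+ 2 + w ^+ 2) / (s * w) ^+ 2.
  have x2 : x ^+ 2 = 1 - w ^+ 2 by rewrite w2; ring.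
  by field: x2 s2; rewrite w0 s0.
by field: s2; rewrite w0 s0 aw.
Qed.

Lemma cvg_sqrt1B_kernel a x : -1 < x < 1 ->
  {for x, continuous (fun y => sqrt1B y / (a ^+ 2 + 1 - y ^+ 2))}.
Proof.
move=> x1; apply: cvgM; first exact: continuous_sqrt1B.
apply: cvgV; last by apply: cvgB; [exact: cvg_cst|exact: exprn_continuous].
by rewrite -addrA lt0r_neq0// ltr_wpDl ?sqr_ge0// subr1_sqr_gt0.
Qed.

Lemma sqrt1B_kernel_ge0 a x : -1 < x < 1 ->
  0 <= sqrt1B x / (a ^+ 2 + 1 - x ^+ 2).
Proof.
move=> x1; rewrite divr_ge0 ?sqrtr_ge0// -addrA.
by rewrite addr_ge0 ?sqr_ge0// ltW// subr1_sqr_gt0.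
Qed.

Lemma integral_semicircle :
  (\int[lebesgue_measure]_(x in `](-1)%R, 1%R[) (sqrt1B x)%:E = (pi / 2 : R)%:E)%E.
Proof.
apply: (ge0_integral_oo_FTC _ _ is_derive_semicircle).
- by move=> x _; exact: sqrtr_ge0.
- by move=> x _; exact: continuous_sqrt1B.
rewrite [X in X @ _ --> _](_ : _ =
    fun n => sin_atan n * cos (atan n.+1%:R) + atan n.+1%:R).
  rewrite -[X in _ --> X]add0r -(mulr0 1); apply: cvgD; last exact: cvg_atan_nat.
  by apply: cvgM; [exact: cvg_sin_atan|exact: cvg_cos_atan].
apply/funext => n; rewrite asinN_sin_atan asin_sin_atan /sqrt1B sqrrN sqrt_sin_atan.
by field.
Qed.

Lemma cvg_kernel_antiderivative a : 0 <= a ->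
  let F y := asin y -
      a / Num.sqrt (a ^+ 2 + 1) * atan (a / Num.sqrt (a ^+ 2 + 1) * (y / sqrt1B y)) in
  F (sin_atan n) - F (- sin_atan n) @[n --> \oo] -->
    pi * (1 - a / Num.sqrt (a ^+ 2 + 1)).
Proof.
move=> a0 F; rewrite {}/F; set c := a / _.
have c0 : 0 <= c by rewrite divr_ge0 ?sqrtr_ge0.
rewrite [X in X @ _ --> _](_ : _ =
    fun n => 2 * (atan n.+1%:R - c * atan (c * n.+1%:R))); last first.
  apply/funext => n; rewrite asinN_sin_atan asin_sin_atan.
  rewrite /sqrt1B sqrrN mulNr sin_atan_div mulrN atanN; ring.
have -> : pi * (1 - c) = 2 * (pi / 2 - c * (pi / 2)) by field.
apply: cvgM; first exact: cvg_cst.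
apply: cvgB; first exact: cvg_atan_nat.
(* For c = 0 the arctangent stays at 0 and does not tend to pi / 2; both sides vanish through the
   factor c. *)
move: c0; rewrite le_eqVlt => /predU1P[<-|c0].
  by under eq_fun do rewrite mul0r; rewrite mul0r; exact: cvg_cst.
by apply: cvgM; [exact: cvg_cst|exact: cvg_atanM_nat].
Qed.

Lemma integral_kernel a : 0 <= a ->
  (\int[lebesgue_measure]_(x in `](-1)%R, 1%R[)
     (sqrt1B x / (a ^+ 2 + 1 - x ^+ 2))%:E =
   (pi * (1 - a / Num.sqrt (a ^+ 2 + 1)))%:E)%E.
Proof.
move=> a0; apply: (ge0_integral_oo_FTC _ _ (@is_derive_kernel a)).
- by move=> x; exact: sqrt1B_kernel_ge0.
- by move=> x; exact: cvg_sqrt1B_kernel.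
- exact: cvg_kernel_antiderivative.
Qed.

(* The factor 1 + x rather than x keeps the integrand nonnegative. *)
Lemma integral_kernel1D a : 0 <= a ->
  (\int[lebesgue_measure]_(x in `](-1)%R, 1%R[)
     ((1 + x) * (sqrt1B x / (a ^+ 2 + 1 - x ^+ 2)))%:E =
   (pi * (1 - a / Num.sqrt (a ^+ 2 + 1)))%:E)%E.
Proof.
move=> a0; set c := a / _.
pose F y := asin y - c * atan (c * (y / sqrt1B y)) +
  (a * atan (sqrt1B y / a) - sqrt1B y).
apply: (@ge0_integral_oo_FTC R
  (fun x => (1 + x) * (sqrt1B x / (a ^+ 2 + 1 - x ^+ 2))) F).
- move=> x x1; rewrite mulr_ge0 ?sqrt1B_kernel_ge0//.
  by have /andP[? _] := x1; lra.
- move=> x x1; apply: cvgM; last exact: cvg_sqrt1B_kernel.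
  by apply: cvgD; [exact: cvg_cst|exact: cvg_id].
- move=> x x1; have dk := is_derive_kernel a x1.
  have da := is_derive_atan_sqrt1B a x1.
  by have := is_deriveD dk da; move=> /is_derive_eq; apply; rewrite mulrDl mul1r.
(* The part of F coming from the term x is even, so it cancels between opposite points and the limit
   is that of [integral_kernel]. *)
- rewrite [X in X @ _ --> _](_ : _ = fun n =>
     (asin (sin_atan n) - c * atan (c * (sin_atan n / sqrt1B (sin_atan n)))) -
     (asin (- sin_atan n) - c * atan (c * (- sin_atan n / sqrt1B (- sin_atan n))))).
    exact: cvg_kernel_antiderivative.
  by apply/funext => n; rewrite /F /sqrt1B sqrrN; ring.
Qed.

Lemma chebU_acos (n : nat) x : -1 < x < 1 ->
  (chebU n).[x] * sqrt1B x = sin (n.+1%:R * acos x).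
Proof.
move=> x1; have xI : -1 <= x <= 1 by have /andP[/ltW-> /ltW->] := x1.
have w0 := lt0r_neq0 (sqrt1B_gt0 x1).
have sE : sin (acos x) = sqrt1B x by exact: sin_acos.
have := @chebUP R n (acos x); rewrite acosK ?in_itv// sE => ->//.
by rewrite divfK.
Qed.

Lemma is_derive_sin_acos (k : R) x : -1 < x < 1 ->
  is_derive x 1 (fun y => sin (k * acos y))
    (- k * cos (k * acos x) / sqrt1B x).
Proof.
move=> x1; have da := is_derive1_acos x1.
have dk : is_derive x 1 (fun y => k * acos y) (- k / sqrt1B x).
  by apply: is_derive_eq; rewrite /GRing.scale/= -/(sqrt1B x); ring.
have := @is_derive1_comp R sin (fun y => k * acos y) x _ _ (is_derive_sin _) dk.
by move=> /is_derive_eq; apply; ring.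
Qed.

(* From the integral of sin((n+2)t) sin t, with x = cos t; multiplying U_k by
   sqrt(1 - x^2) makes it continuous up to the endpoints, where it vanishes. *)
Definition chebU_primitive (n : nat) x : R :=
  2^-1 * ((chebU n.+2).[x] * sqrt1B x / n.+3%:R - (chebU n).[x] * sqrt1B x / n.+1%:R).

Lemma is_derive_chebU_primitive n x : -1 < x < 1 ->
  is_derive x 1 (chebU_primitive n) ((chebU n.+1).[x] * sqrt1B x).
Proof.
move=> x1; have w0 := lt0r_neq0 (sqrt1B_gt0 x1).
have xI : -1 <= x <= 1 by have /andP[/ltW-> /ltW->] := x1.
pose T (y : R) := 2^-1 * (sin (n.+3%:R * acos y) / n.+3%:R - sin (n.+1%:R * acos y) / n.+1%:R).
have dT : is_derive x 1 T ((chebU n.+1).[x] * sqrt1B x).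
  have d3 := is_derive_sin_acos n.+3%:R x1.
  have d1 := is_derive_sin_acos n.+1%:R x1.
  rewrite /T; apply: is_derive_eq; rewrite /GRing.scale/= chebU_acos//.
  have -> : n.+3%:R * acos x = n.+2%:R * acos x + acos x by ring.
  have -> : n.+1%:R * acos x = n.+2%:R * acos x - acos x by ring.
  rewrite cosB cosD sin_acos// -/(sqrt1B x).
  by field; rewrite w0 nat1r -natrD !pnatr_eq0.
(* The trigonometric form agrees with [chebU_primitive] on ]-1, 1[, a neighbourhood of x. *)
apply: near_eq_is_derive dT.
have /near_in_itvoo xoo : x \in `]-1, 1[ by rewrite in_itv.
near=> y; rewrite /T /chebU_primitive !chebU_acos//.
all: by near: y; apply: filterS xoo => y; rewrite in_itv.
Unshelve. all: by end_near. Qed.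

Lemma continuous_chebU_primitive n : continuous (chebU_primitive n).
Proof.
have cU (k : nat) : continuous (fun x => (chebU k).[x] * sqrt1B x).
  move=> x; apply: cvgM; [exact: continuous_horner|exact: continuous_sqrt1B].
move=> x; apply: cvgM; first exact: cvg_cst.
by apply: cvgB; (apply: cvgM; [exact: cU|exact: cvg_cst]).
Qed.

(** The integrand changes sign, so the monotone exhaustion does not apply. Integrand and primitive
    are continuous on the closed interval, and the primitive vanishes at both ends through its
    factor sqrt(1 - x^2). *)
Lemma integral_chebU (n : nat) :
  (\int[lebesgue_measure]_(x in `](-1)%R, 1%R[)
     ((chebU n.+1).[x] * sqrt1B x)%:E = 0)%E.
Proof.
have cU : continuous (fun x => (chebU n.+1).[x] * sqrt1B x).
  move=> x; apply: cvgM; [exact: continuous_horner|exact: continuous_sqrt1B].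
rewrite -(@integral_itv_bndoo _ _ _ _ true false); last first.
  by apply/measurable_EFinP/measurable_funTS; exact: continuous_measurable_fun.
rewrite (@continuous_FTC2 _ _ (chebU_primitive n))//.
- by rewrite -EFinB; congr (_%:E); rewrite /chebU_primitive /sqrt1B sqrrN expr1n subrr sqrtr0; ring.
- exact: continuous_subspaceT.
- split.
  + by move=> x; rewrite in_itv/= => /(is_derive_chebU_primitive n)[].
  + exact/cvg_at_right_filter/continuous_chebU_primitive.
  + exact/cvg_at_left_filter/continuous_chebU_primitive.
- move=> x; rewrite in_itv/= => x1; rewrite derive1E.
  by have [] := is_derive_chebU_primitive n x1.
Qed.

End antiderivatives.

(** * Moments of xi *)

Section finite_moments_lemmas.
Context {R : realType}.
Implicit Types (mu nu : {measure set (measurableTypeR R) -> \bar R}).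

Lemma finite_moments_measure_add mu nu :
  finite_moments mu -> finite_moments nu -> finite_moments (measure_add mu nu).
Proof.
move=> fmu fnu n; have [mX muX] := integrableP _ _ _ (fmu n).
have [_ nuX] := integrableP _ _ _ (fnu n).
apply/integrableP; split=> //; rewrite ge0_integral_measure_add//.
  exact: lte_add_pinfty.
exact: measurableT_comp.
Qed.

Lemma finite_moments_mscale (c : {nonneg R}) mu :
  finite_moments mu -> finite_moments (mscale c mu).
Proof.
move=> fmu n; have [mX muX] := integrableP _ _ _ (fmu n).
apply/integrableP; split=> //; rewrite ge0_integral_mscale//.
  by rewrite lte_mul_pinfty// ?lee_fin// fin_numE.
exact: measurableT_comp.
Qed.

Lemma finite_moments_dirac (a : R) :
  finite_moments (dirac (a : measurableTypeR R)).
Proof.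
move=> n; have mX : measurable_fun setT (fun x : R => (x ^+ n)%:E).
  by apply/measurable_EFinP; exact: exprn_measurable.
apply/integrableP; split=> //; rewrite integral_dirac//.
  by rewrite diracT mul1e ltry.
exact: measurableT_comp.
Qed.

Lemma moment_measure_add mu nu p :
  finite_moments mu -> finite_moments nu ->
  moment (measure_add mu nu) p = moment mu p + moment nu p.
Proof.
move=> fmu fnu; apply: EFin_inj.
rewrite -integral_moment; last exact: finite_moments_measure_add.
rewrite integral_measure_add//; [|exact: integrable_horner..].
by rewrite !integral_moment.
Qed.

Lemma moment_mscale_dirac (c : {nonneg R}) (a : R) p :
  moment (mscale c (dirac (a : measurableTypeR R))) p = c%:num * p.[a].
Proof.
have mp : measurable_fun setT (fun x : R => p.[x]%:E).
  by apply/measurable_EFinP; exact: measurable_poly.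
(* Scaling is applied to nonnegative integrands, hence the positive and negative parts, reassembled
   at the end. *)
rewrite /moment /Rintegral integralE !ge0_integral_mscale//; last 2 first.
- exact: measurable_funeneg.
- exact: measurable_funepos.
rewrite !integral_dirac//; last 2 first.
- exact: measurable_funeneg.
- exact: measurable_funepos.
rewrite !diracT !mul1e -muleBr//; last exact: add_def_funeposneg.
by have /(congr1 (@^~ a)) <- := funeposneg (fun x : R => p.[x]%:E).
Qed.

End finite_moments_lemmas.

Section xi_moments.
Context {R : realType} (lambda : R) (hlambda : 0 < lambda <= 1).
Local Notation a := (aparam lambda).
Local Notation s := (xi_atom lambda).

Lemma aparam_ge0 : 0 <= a.
Proof.
by have /andP[_ l1] := hlambda; rewrite divr_ge0 ?sqrtr_ge0// subr_ge0.
Qed.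

Lemma sqr_xi_atom : s ^+ 2 = a ^+ 2 + 1.
Proof. by rewrite sqr_sqrtr// addr_ge0// sqr_ge0. Qed.

Lemma xi_atom_gt0 : 0 < s.
Proof. by rewrite sqrtr_gt0 ltr_wpDl// sqr_ge0. Qed.

Lemma integral_xi_ac (f : R -> R) : measurable_fun setT f ->
  (\int[xi_ac lambda]_x (f x)%:E = \int[lebesgue_measure]_(x in `](-1)%R, 1%R[)
    (pi^-1 * (f x * (sqrt1B x / (a ^+ 2 + 1 - x ^+ 2))))%:E)%E.
Proof.
move=> mf; rewrite (@integral_density _ _ _ lebesgue_measure _ (xi_density lambda))//.
- rewrite [RHS]integral_mkcond; apply: eq_integral => x _.
  rewrite patchE mem_setE in_itv/= -ltr_norml /xi_density -EFinM.
  by case: ifPn => _; rewrite ?mulr0// mulrCA.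
- exact: measurable_xi_density.
- exact: xi_density_ge0.
- exact/measurable_EFinP.
Qed.

Lemma measurable_kernel (f : R -> R) : measurable_fun setT f ->
  measurable_fun (`]-1, 1[%classic : set R)
    (fun x : R => f x * (sqrt1B x / (a ^+ 2 + 1 - x ^+ 2))).
Proof.
move=> mf; apply: measurable_funM; first exact: measurable_funTS.
apply: open_continuous_measurable_fun; first exact: interval_open.
by move=> x /set_mem; rewrite /= in_itv/=; exact: cvg_sqrt1B_kernel.
Qed.

Lemma xi_ac_setT : xi_ac lambda setT = (1 - a / s)%:E.
Proof.
have -> : xi_ac lambda setT = (\int[xi_ac lambda]_x (1 : R)%:E)%E.
  by rewrite integral_cst// mul1e.
rewrite integral_xi_ac//.
under eq_integral do rewrite EFinM.
rewrite ge0_integralZl//.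
- under eq_integral do rewrite mul1r.
  rewrite integral_kernel ?aparam_ge0// -EFinM mulKf//.
  by rewrite lt0r_neq0// pi_gt0.
- by apply/measurable_EFinP; exact: measurable_kernel.
- by move=> x; rewrite /= in_itv/= lee_fin mul1r => /sqrt1B_kernel_ge0.
- by rewrite lee_fin invr_ge0 pi_ge0.
Qed.

(** The density lives on ]-1, 1[, where |x^n| <= 1, so the finite total mass dominates every
    absolute moment. *)
Lemma finite_moments_xi_ac : finite_moments (xi_ac lambda).
Proof.
move=> n; apply/integrableP; split.
  by apply/measurable_EFinP; exact: exprn_measurable.
apply: (@le_lt_trans _ _ (\int[xi_ac lambda]_x (1 : R)%:E)%E); last first.
  by rewrite integral_cst//= mul1e xi_ac_setT ltry.
rewrite (integral_xi_ac (f := fun x => `|x ^+ n|)); last first.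
  by apply: measurableT_comp => //; exact: exprn_measurable.
rewrite integral_xi_ac//; apply: ge0_le_integral => //.
- move=> x; rewrite /= in_itv/= lee_fin => x1.
  by rewrite mulr_ge0 ?invr_ge0 ?pi_ge0// mulr_ge0 ?sqrt1B_kernel_ge0.
- apply/measurable_EFinP/measurable_funM => //; apply: measurable_kernel.
  by apply: measurableT_comp => //; exact: exprn_measurable.
- by apply/measurable_EFinP/measurable_funM => //; exact: measurable_kernel.
- move=> x; rewrite /= in_itv/= lee_fin => x1.
  rewrite ler_wpM2l ?invr_ge0 ?pi_ge0// ler_wpM2r ?sqrt1B_kernel_ge0//.
  by rewrite normrX exprn_ile1// ltW// ltr_norml.
Qed.

Lemma finite_moments_xi : finite_moments (xi hlambda).
Proof.
apply: finite_moments_measure_add finite_moments_xi_ac.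
exact/finite_moments_mscale/finite_moments_dirac.
Qed.

Lemma moment_xi p : moment (xi hlambda) p = a / s * p.[s] + moment (xi_ac lambda) p.
Proof.
rewrite -(moment_mscale_dirac (NngNum (atom_weight_ge0 hlambda))).
apply: moment_measure_add finite_moments_xi_ac.
exact/finite_moments_mscale/finite_moments_dirac.
Qed.

Lemma moment_xi_ac1 : moment (xi_ac lambda) 1 = 1 - a / s.
Proof.
apply: EFin_inj; rewrite -(integral_moment finite_moments_xi_ac) -xi_ac_setT.
by under eq_integral do rewrite hornerC; rewrite integral_cst// mul1e.
Qed.

(** Same value as for the polynomial 1: the density is even, so the absolutely continuous part has
    mean contribution 0. *)
Lemma moment_xi_ac1X : moment (xi_ac lambda) (1 + 'X) = 1 - a / s.
Proof.
apply: EFin_inj; rewrite -(integral_moment finite_moments_xi_ac).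
rewrite (integral_xi_ac (f := horner (1 + 'X))); last exact: measurable_poly.
under eq_integral do rewrite hornerD hornerX hornerC EFinM.
rewrite ge0_integralZl//.
- rewrite integral_kernel1D ?aparam_ge0// -EFinM mulKf//.
  by rewrite lt0r_neq0// pi_gt0.
- apply/measurable_EFinP; apply: measurable_kernel.
  by apply: measurable_funD => //; exact: measurable_id.
- move=> x; rewrite /= in_itv/= lee_fin => x1.
  rewrite mulr_ge0 ?sqrt1B_kernel_ge0//.
  by have /andP[? _] := x1; lra.
- by rewrite lee_fin invr_ge0 pi_ge0.
Qed.

(* The atom sits at a zero of atom_poly and its other factor cancels the
   denominator of the density, leaving the semicircle weight. *)
Lemma moment_xi_atom_poly p : moment (xi hlambda) (atom_poly lambda * p) =
  (\int[lebesgue_measure]_(x in `](-1)%R, 1%R[) (pi^-1 * (p.[x] * sqrt1B x)))%R.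
Proof.
rewrite moment_xi hornerM [(atom_poly _).[s]]hornerD hornerN hornerC hornerXn.
rewrite sqr_xi_atom subrr mul0r mulr0 add0r /moment /Rintegral.
rewrite (integral_xi_ac (f := horner (atom_poly lambda * p))); last exact: measurable_poly.
congr fine; apply: eq_integral => x; rewrite inE/= in_itv/= => x1.
rewrite hornerM [(atom_poly _).[x]]hornerD hornerN hornerC hornerXn; congr (_%:E).
have d0 : a ^+ 2 + 1 - x ^+ 2 != 0.
  by rewrite -addrA lt0r_neq0// ltr_wpDl ?sqr_ge0// subr1_sqr_gt0.
by congr (_ * _); move: (_ - _) d0 => d d0; field.
Qed.

Lemma moment_atom_poly : moment (xi hlambda) (atom_poly lambda) = 1 / 2.
Proof.
rewrite -[atom_poly _]mulr1 moment_xi_atom_poly /Rintegral.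
under eq_integral do rewrite hornerC mul1r EFinM.
rewrite ge0_integralZl//.
- by rewrite integral_semicircle -EFinM /= mulrA mulVf// lt0r_neq0// pi_gt0.
- apply/measurable_EFinP/measurable_funTS.
  by apply: continuous_measurable_fun; exact: continuous_sqrt1B.
- by move=> x _; rewrite lee_fin sqrtr_ge0.
- by rewrite lee_fin invr_ge0 pi_ge0.
Qed.

Lemma moment_atom_poly_chebU (n : nat) :
  moment (xi hlambda) (atom_poly lambda * chebU n.+1) = 0.
Proof.
rewrite moment_xi_atom_poly RintegralZl//.
  by rewrite /Rintegral integral_chebU mulr0.
have : lebesgue_measure.-integrable (`[-1, 1]%classic : set R)
    (EFin \o (fun x : R => (chebU n.+1).[x] * sqrt1B x)).
  apply: continuous_compact_integrable; first exact: segment_compact.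
  apply: continuous_subspaceT => x.
  by apply: cvgM; [exact: continuous_horner|exact: continuous_sqrt1B].
by apply: integrableS => //; exact: subset_itv_oo_cc.
Qed.

Lemma moment_xi1 : moment (xi hlambda) 1 = 1.
Proof. by rewrite moment_xi moment_xi_ac1 hornerC mulr1 subrKC. Qed.

Lemma moment_xiX : moment (xi hlambda) 'X = a.
Proof.
(* Adding the moment of 1 turns X into 1 + X, whose integral is known; the value a comes from the
   atom alone, as (a / s) s. *)
apply: (addrI 1); rewrite -{1}moment_xi1.
rewrite -(momentD (moment_linear finite_moments_xi)) moment_xi moment_xi_ac1X.
rewrite hornerD hornerX hornerC.
by have := xi_atom_gt0; move: s => t t0; field; rewrite lt0r_neq0.
Qed.

Lemma moment_Plambda n : (0 < n)%N -> moment (xi hlambda) (Plambda lambda n) = 0.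
Proof.
have lin := moment_linear finite_moments_xi.
have P1 : moment (xi hlambda) (Plambda lambda 1) = 0.
  rewrite Plambda1 (momentZ lin) -[(aparam _)%:P]mulr1 mul_polyC (momentB lin).
  by rewrite (momentZ lin) moment_xiX moment_xi1 mulr1 subrr mulr0.
(* Integrating [atom_polyE0] gives 4 / 2 = 1 - (L(P_2) + 0 - 1). *)
have P2 : moment (xi hlambda) (Plambda lambda 2) = 0.
  have := congr1 (moment (xi hlambda)) (atom_polyE0 lambda).
  rewrite (momentZ lin 4) (momentB lin 1) (momentB lin _ 1) (momentD lin).
  rewrite (momentZ lin (2 * _)) P1 moment_xi1 moment_atom_poly; lra.
(* Again two consecutive indices: [atom_polyEU] expresses P_(k+3) through P_(k+1), P_(k+2) and a
   term of zero moment. *)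
suff : forall k, moment (xi hlambda) (Plambda lambda k.+1) = 0 /\
    moment (xi hlambda) (Plambda lambda k.+2) = 0 by case: n => // n /(_ n)[].
elim=> [//|k [Pk Pk1]]; split=> //.
have := congr1 (moment (xi hlambda)) (atom_polyEU lambda k).
rewrite (momentZ lin 4) moment_atom_poly_chebU (momentB lin (Plambda _ _)).
by rewrite (momentD lin) (momentZ lin (2 * _)) Pk Pk1; lra.
Qed.

Lemma xi_setT : xi hlambda setT = 1%E.
Proof.
have := integral_moment finite_moments_xi 1; rewrite moment_xi1 => <-.
by under eq_integral do rewrite hornerC; rewrite integral_cst// mul1e.
Qed.

(** A finite set is Lebesgue null, so a finite support would force the absolutely continuous part to
    have mass 0. Its mass is 1 - a / s, positive because s^2 = a^2 + 1. *)
Lemma not_finitely_supported_xi : ~ finitely_supported (xi hlambda).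
Proof.
move=> [F finF].
have mF : measurable (F : set (measurableTypeR R)).
  exact/countable_measurable/finite_set_countable.
rewrite [xi _ _]measure_addE => xi0.
have acF : xi_ac lambda F = 0%E.
  apply: null_set_integral => //.
  - apply/measurable_EFinP/measurable_funTS; exact: measurable_xi_density.
  - exact/countable_lebesgue_measure0/finite_set_countable.
have acFC : xi_ac lambda (~` F) = 0%E.
  apply/eqP; rewrite eq_le measure_ge0 andbT -[leRHS]xi0.
  by rewrite leeDr// measure_ge0.
have : xi_ac lambda setT = 0%E.
  rewrite -(setvU F) measureU//; [|exact: measurableC|exact: setICl].
  by have := f_equal2 (fun x y => (x + y)%E) acFC acF; rewrite adde0.
rewrite xi_ac_setT => /eqP; rewrite eqe subr_eq0 eq_sym.
apply/negP; rewrite lt_eqF// ltr_pdivrMr ?xi_atom_gt0// mul1r.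
rewrite -(ltr_pXn2r (n := 2)) ?nnegrE ?aparam_ge0 ?(ltW xi_atom_gt0)//.
by rewrite sqr_xi_atom ltrDl.
Qed.

(** * Monic normalization and the Jacobi-Szegö parameters *)

Definition monic_Plambda n : {poly R} := 2 ^- n *: Plambda lambda n.

(** Dividing P_n by its leading coefficient 2^n turns the coefficient 1 of P_(n-1) into 1/4, and the
    exceptional 2 in P_2 into 1/2. The sequences are kept generic so that the lemma also serves the
    converse half of [jacobi_szego_xi]. *)
Lemma monic_Plambda_three_term (alpha omega : nat -> R) :
  alpha 0%N = a -> (forall n, (1 <= n)%N -> alpha n = 0) ->
  omega 1%N = 1 / 2 -> (forall n, (2 <= n)%N -> omega n = 1 / 4) ->
  three_term monic_Plambda alpha omega.
Proof.
move=> al0 al om1 om n; rewrite /monic_Plambda.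
have half k : 2 ^- k.+1 * 2 = 2 ^- k :> R by rewrite exprS; field.
case: n => [|[|n]].
- by rewrite al0 scaler0 addr0 Plambda0 Plambda1 -scalerAr mulr1 scalerA half.
- rewrite al// om1 subr0 Plambda2 Plambda0 -[2%:P]mulr1 mul_polyC -scalerAr.
  rewrite scalerBr !scalerA !half.
  have -> : 1 / 2 * 2 ^- 0 = 2 ^- 1 :> R by field.
  by rewrite subrK.
- rewrite al// om// subr0 PlambdaSSS -scalerAr scalerBr !scalerA half.
  have -> : 1 / 4 * 2 ^- n.+1 = 2 ^- n.+3 :> R by rewrite !exprS; field.
  by rewrite subrK.
Qed.

Lemma Plambda_monicE n : Plambda lambda n = 2 ^+ n *: monic_Plambda n.
Proof. by rewrite scalerA divff ?scale1r// expf_neq0. Qed.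

Lemma monic_Plambda0 : monic_Plambda 0 = 1.
Proof. by rewrite /monic_Plambda Plambda0 expr0 invr1 scale1r. Qed.

Lemma moment_monic_Plambda n : (0 < n)%N ->
  moment (xi hlambda) (monic_Plambda n) = 0.
Proof.
move=> n0; rewrite (momentZ (moment_linear finite_moments_xi)).
by rewrite moment_Plambda// mulr0.
Qed.

Definition Plambda_alpha (n : nat) : R := if n is 0%N then a else 0.
Definition Plambda_omega (n : nat) : R := if (n <= 1)%N then 1 / 2 else 1 / 4.

Lemma three_term_Plambda : three_term monic_Plambda Plambda_alpha Plambda_omega.
Proof. by apply: monic_Plambda_three_term => // -[|[|n]]. Qed.

Lemma orthogonal_monic_Plambda : orthogonal_polys (xi hlambda) monic_Plambda.
Proof.
split; first exact: finite_moments_xi.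
  by move=> n; have [] := three_term_monic monic_Plambda0 three_term_Plambda n.
move=> m n mn; rewrite (integral_moment finite_moments_xi).
by rewrite (three_term_orthogonal (moment_linear finite_moments_xi)
  monic_Plambda0 three_term_Plambda moment_monic_Plambda mn).
Qed.

Lemma orthogonal_Plambda : orthogonal_polys (xi hlambda) (Plambda lambda).
Proof.
have [fm sP oP] := orthogonal_monic_Plambda; split=> // [n|m n mn].
  by rewrite Plambda_monicE size_scale ?sP// expf_neq0.
rewrite (integral_moment fm) !Plambda_monicE -scalerAl -scalerAr scalerA.
rewrite (momentZ (moment_linear fm)).
by rewrite EFinM -(integral_moment fm) oP// mule0.
Qed.

Lemma jacobi_szego_xi (alpha omega : nat -> R) :
  jacobi_szego (xi hlambda) alpha omega <->
  [/\ alpha 0%N = a, (forall n : nat, (1 <= n)%N -> alpha n = 0),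
      omega 1%N = 1 / 2 & (forall n : nat, (2 <= n)%N -> omega n = 1 / 4)].
Proof.
have monicP n : monic_Plambda n \is monic.
  by have [] := three_term_monic monic_Plambda0 three_term_Plambda n.
split=> [[_ nfs _ [P [oP mP rec]]]|[al0 al om1 om]].
  have sizeP n : size (monic_Plambda n) = n.+1.
    by have [] := three_term_monic monic_Plambda0 three_term_Plambda n.
  (* Any witness family must be this one, so its coefficients can be compared with the known
     ones. *)
  have PE : P = monic_Plambda.
    apply/funext; apply: monic_orthogonal_polys_unique nfs oP _ mP monicP.
      exact: finite_moments_xi.
    exact: orthogonal_monic_Plambda.
  rewrite PE in rec.
  have E n := three_term_coef_unique sizeP rec three_term_Plambda n.
  split.
  - exact: (E 0%N).1.
  - by case=> // n _; exact: (E n.+1).1.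
  - exact: (E 1%N).2.
  - by case=> [|[|n]]// _; exact: (E n.+2).2.
split; first exact: finite_moments_xi.
- exact: not_finitely_supported_xi.
- by case=> // -[|n] _; rewrite ?om1 ?om// divr_gt0.
- exists monic_Plambda; split=> //; first exact: orthogonal_monic_Plambda.
  exact: monic_Plambda_three_term.
Qed.

End xi_moments.

Theorem mainTheorem5 (R : realType) (lambda : R) (hlambda : 0 < lambda <= 1) :
  [/\ xi hlambda setT = 1%E,
      orthogonal_polys (xi hlambda) (Plambda lambda) &
      forall alpha omega : nat -> R,
        jacobi_szego (xi hlambda) alpha omega <->
        [/\ alpha 0%N = aparam lambda,
            (forall n : nat, (1 <= n)%N -> alpha n = 0),
            omega 1%N = 1 / 2 &
            (forall n : nat, (2 <= n)%N -> omega n = 1 / 4)]].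
Proof.
split; first exact: xi_setT.
- exact: orthogonal_Plambda.
- exact: jacobi_szego_xi.
Qed.
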